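(* No $\ge 2$-subdivision of $K_4$ is a restricted frame graph.
   Context: A $\ge 2$-subdivision of $K_4$ is a graph obtained from $K_4$ by replacing every edge by a path with at least $3$ edges. A frame is the boundary of an axis-parallel box $I\times J\subset\mathbb R^2$. A graph $G$ is a restricted frame graph if there is a family of frames $\{F_v : v\in V(G)\}$ with $uv\in E(G)$ iff $F_u\cap F_v\neq\emptyset$, satisfying: (1) corners of a frame do not coincide with any point of another frame; (2) the left side of any frame does not intersect any other frame; (3) if the right side of a frame intersects a second frame, this right side intersects both the top and the bottom side of the second frame; (4) if two frames have non-empty intersection, then no frame is entirely contained in the intersection of the two regions bounded by these two frames. *)

(* Defs.v *)
From Stdlib Require Import Reals.
From mathcomp Require Import all_boot.

Set Implicit Arguments.
Unset Strict Implicit.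
Unset Printing Implicit Defensive.

(* Graphs: a simple graph on a finite vertex type V is given by an     *)
(* adjacency relation [adj : rel V] (symmetric, irreflexive).          *)

Definition consec {T : eqType} (s : seq T) (x y : T) : Prop :=
  exists k, k.+1 < size s /\ nth x s k = x /\ nth x s k.+1 = y.

Definition K4_pairs : seq ('I_4 * 'I_4) :=
  [seq p : 'I_4 * 'I_4 <- [seq (i, j) | i <- enum 'I_4, j <- enum 'I_4] | p.1 < p.2].

(* G = (V, adj) is a >=2-subdivision of K_4: there are 4 distinct branch
   vertices b 0..b 3 and, for every pair i < j, a list P i j of interior
   vertices such that the path b i, P i j, b j has at least 3 edges
   (i.e. at least 2 interior vertices); all branch and interior vertices
   are pairwise distinct (paths are internally disjoint and simple); every
   vertex of G is one of them; and the edges of G are exactly the pairs of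
   consecutive vertices on these six paths. *)

Definition subdiv_path {V : finType} (b : 'I_4 -> V) (P : 'I_4 -> 'I_4 -> seq V)
    (p : 'I_4 * 'I_4) : seq V :=
  b p.1 :: rcons (P p.1 p.2) (b p.2).

Definition ge2_subdivision_K4 (V : finType) (adj : rel V) : Prop :=
  exists (b : 'I_4 -> V) (P : 'I_4 -> 'I_4 -> seq V),
    let all_vertices :=
      [seq b i | i <- enum 'I_4] ++ flatten [seq P p.1 p.2 | p <- K4_pairs] in
    [/\ (forall p, p \in K4_pairs -> 2 <= size (P p.1 p.2)),
        uniq all_vertices,
        (forall v : V, v \in all_vertices) &
        (forall x y : V, adj x y <->
           exists2 p, p \in K4_pairs &
             (consec (subdiv_path b P p) x y \/ consec (subdiv_path b P p) y x))].

Local Open Scope R_scope.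

Record frame := Frame {
  fx1 : R; fx2 : R; fy1 : R; fy2 : R;
  fx_lt : fx1 < fx2; fy_lt : fy1 < fy2 }.

Definition pt := (R * R)%type.

Definition in_box (F : frame) (p : pt) : Prop :=
  fx1 F <= fst p <= fx2 F /\ fy1 F <= snd p <= fy2 F.

Definition left_side (F : frame) (p : pt) : Prop :=
  fst p = fx1 F /\ fy1 F <= snd p <= fy2 F.
Definition right_side (F : frame) (p : pt) : Prop :=
  fst p = fx2 F /\ fy1 F <= snd p <= fy2 F.
Definition bottom_side (F : frame) (p : pt) : Prop :=
  snd p = fy1 F /\ fx1 F <= fst p <= fx2 F.
Definition top_side (F : frame) (p : pt) : Prop :=
  snd p = fy2 F /\ fx1 F <= fst p <= fx2 F.

Definition on_frame (F : frame) (p : pt) : Prop :=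
  left_side F p \/ right_side F p \/ bottom_side F p \/ top_side F p.

Definition corner (F : frame) (p : pt) : Prop :=
  (fst p = fx1 F \/ fst p = fx2 F) /\ (snd p = fy1 F \/ snd p = fy2 F).

Definition meets (A B : pt -> Prop) : Prop := exists p, A p /\ B p.

Definition restricted_frame_graph (V : finType) (adj : rel V) : Prop :=
  exists F : V -> frame,
    [/\
        (forall u v : V, u != v -> (adj u v <-> meets (on_frame (F u)) (on_frame (F v)))),
        (forall u v : V, u != v -> forall p, corner (F u) p -> ~ on_frame (F v) p),
        (forall u v : V, u != v -> ~ meets (left_side (F u)) (on_frame (F v))),
        (forall u v : V, u != v -> meets (right_side (F u)) (on_frame (F v)) ->
           meets (right_side (F u)) (top_side (F v)) /\
           meets (right_side (F u)) (bottom_side (F v))) &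
        (forall u v : V, u != v -> meets (on_frame (F u)) (on_frame (F v)) ->
           forall w : V, ~ (forall p, on_frame (F w) p -> in_box (F u) p /\ in_box (F v) p))].

(* Main.v *)
Require Import Defs.
From Stdlib Require Import Reals Lra Classical.
From mathcomp Require Import all_boot zify.

(** Two intersecting frames cross in only one way: one of them starts inside the other and
    pokes out through its right side, so that its left side lies further to the right. Two
    disjoint frames are separated or nested.

    Call a frame big if another frame is nested in it. A frame [v] separates the frames nested
    in it from the other non-neighbours of [v]. Removing a closed neighbourhood from a
    >=2-subdivision of K_4 leaves a connected graph, so a big frame contains all its
    non-neighbours, and any two big frames are adjacent. On each of the four subdivided
    triangles, the frame with the rightmost left side pokes out of its two neighbours on the
    cycle; these are disjoint and overlap, hence nested, and one of them is big. But no set of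
    pairwise adjacent vertices hits all four subdivided triangles. *)

Set Implicit Arguments.
Unset Strict Implicit.
Unset Printing Implicit Defensive.

Local Open Scope R_scope.

(** * Relative position of two frames in the plane *)

Definition nested (A B : frame) : Prop :=
  [/\ fx1 B < fx1 A, fx2 A < fx2 B, fy1 B < fy1 A & fy2 A < fy2 B].

Definition pokes_out (B A : frame) : Prop :=
  [/\ fx1 A < fx1 B, fx1 B < fx2 A, fx2 A < fx2 B, fy1 A < fy1 B & fy2 B < fy2 A].

Definition separated (A B : frame) : Prop :=
  fx2 A < fx1 B \/ fx2 B < fx1 A \/ fy2 A < fy1 B \/ fy2 B < fy1 A.

Lemma on_frame_vertical (F : frame) (x y : R) :
  x = fx1 F \/ x = fx2 F -> fy1 F <= y <= fy2 F -> on_frame F (x, y).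
Proof. by move=> [->|->] ?; [left | right; left]. Qed.

Lemma on_frame_horizontal (F : frame) (x y : R) :
  y = fy1 F \/ y = fy2 F -> fx1 F <= x <= fx2 F -> on_frame F (x, y).
Proof. by move=> [->|->] ?; right; right; [left | right]. Qed.

Lemma meets_sym (A B : Defs.pt -> Prop) : meets A B -> meets B A.
Proof. by move=> [p [? ?]]; exists p. Qed.

Lemma meets_sides (A B : frame) (x y : R) :
  x = fx1 A \/ x = fx2 A -> y = fy1 B \/ y = fy2 B ->
  fx1 B <= x <= fx2 B -> fy1 A <= y <= fy2 A -> meets (on_frame A) (on_frame B).
Proof.
move=> hx hy xB yA; exists (x, y).
by split; [exact: on_frame_vertical | exact: on_frame_horizontal].
Qed.

(** No vertical side of one frame meets a horizontal side of the other. When the projections overlap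
    in both coordinates, these eight exclusions rule out all orderings of the endpoints but the two
    nestings. *)
Lemma frames_apart (A B : frame) : ~ meets (on_frame A) (on_frame B) ->
  separated A B \/ nested A B \/ nested B A.
Proof.
move=> nm.
have AB x y (hx : x = fx1 A \/ x = fx2 A) (hy : y = fy1 B \/ y = fy2 B) :
    ~ (fx1 B <= x <= fx2 B /\ fy1 A <= y <= fy2 A).
  by move=> [xB yA]; apply: nm; exact: meets_sides xB yA.
have BA x y (hx : x = fx1 B \/ x = fx2 B) (hy : y = fy1 A \/ y = fy2 A) :
    ~ (fx1 A <= x <= fx2 A /\ fy1 B <= y <= fy2 B).
  by move=> [xA yB]; apply/nm/meets_sym; exact: meets_sides xA yB.
have [s|s] := classic (separated A B); [by left | right].
have Ax := fx_lt A; have Ay := fy_lt A; have Bx := fx_lt B; have By := fy_lt B.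
have ovl : [/\ fx1 B <= fx2 A, fx1 A <= fx2 B, fy1 B <= fy2 A & fy1 A <= fy2 B].
  by split; apply: Rnot_lt_le => ?; apply: s; rewrite /separated; tauto.
case: ovl => o1 o2 o3 o4.
(* [l] and [r] select the lower or the upper end in [AB] and [BA]. *)
have l T (z : T) w : z = z \/ z = w by left.
have r T (z : T) w : z = w \/ z = z by right.
have := AB _ _ (l _ _ _) (l _ _ _); have := AB _ _ (l _ _ _) (r _ _ _).
have := AB _ _ (r _ _ _) (l _ _ _); have := AB _ _ (r _ _ _) (r _ _ _).
have := BA _ _ (l _ _ _) (l _ _ _); have := BA _ _ (l _ _ _) (r _ _ _).
have := BA _ _ (r _ _ _) (l _ _ _); have := BA _ _ (r _ _ _) (r _ _ _).
move=> {AB BA l r nm s} h1 h2 h3 h4 h5 h6 h7 h8.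
have [a1|a1] := Rlt_le_dec (fx1 A) (fx1 B);
have [a2|a2] := Rlt_le_dec (fx2 A) (fx2 B);
have [a3|a3] := Rlt_le_dec (fy1 A) (fy1 B);
have [a4|a4] := Rlt_le_dec (fy2 A) (fy2 B);
  first [ exfalso; lra | left; split; lra | right; split; lra ].
Qed.

(** By [frames_apart], [U] is separated from [F] or has [F] nested in it; either way it stays off
    the open box of [F], where [W] lies. *)
Lemma not_meets_across (W U F : frame) :
  nested W F -> ~ nested U F -> ~ meets (on_frame U) (on_frame F) ->
  ~ meets (on_frame W) (on_frame U).
Proof.
move=> [w1 w2 w3 w4] nU /frames_apart sU [[x y] [pW pU]].
have Wx := fx_lt W; have Wy := fy_lt W; have Ux := fx_lt U; have Uy := fy_lt U.
have {pW} [a b] : in_box W (x, y).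
  by move: pW; rewrite /on_frame /in_box /left_side /right_side /bottom_side /top_side /=; lra.
move: pU; rewrite /on_frame /left_side /right_side /bottom_side /top_side /= => pU.
rewrite /= in a b.
case: sU => [|[//|[? ? ? ?]]]; last by lra.
by rewrite /separated; lra.
Qed.

(** The left side of [B] lies strictly inside both boxes, so [A] and [C] cannot be separated. *)
Lemma pokes_out_meets_or_nested (A B C : frame) : pokes_out B A -> pokes_out B C ->
  [\/ meets (on_frame A) (on_frame C), nested A C | nested C A].
Proof.
move=> [a1 a2 a3 a4 a5] [c1 c2 c3 c4 c5].
have By := fy_lt B.
have [m|/frames_apart [s|[n|n]]] := classic (meets (on_frame A) (on_frame C));
  [by constructor 1 | | by constructor 2 | by constructor 3].
by exfalso; move: s; rewrite /separated; lra.
Qed.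

(** The two meeting points give weak forms of all inequalities but [fx1 A < fx1 B]; corners and the
    left side of [B] exclude equality. The remaining one holds since otherwise the left side of [A]
    would cut the bottom of [B]. *)
Lemma right_side_pokes_out (A B : frame) :
  (forall p, corner A p -> ~ on_frame B p) ->
  (forall p, corner B p -> ~ on_frame A p) ->
  ~ meets (left_side A) (on_frame B) -> ~ meets (left_side B) (on_frame A) ->
  meets (right_side A) (top_side B) -> meets (right_side A) (bottom_side B) ->
  pokes_out B A.
Proof.
move=> cA cB lA lB [[x y] [[/= -> hy] [/= ey hx]]] [[x' y'] [[/= -> hy'] [/= ey' hx']]].
rewrite {}ey {}ey' {x y x' y'} in hy hy'.
have Ax := fx_lt A; have Ay := fy_lt A; have Bx := fx_lt B; have By := fy_lt B.
have n1 : fx2 A <> fx1 B.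
  move=> e; apply: lB; exists (fx1 B, fy1 B); split; first by split=> /=; lra.
  by apply: on_frame_vertical; lra.
have n2 : fx2 A <> fx2 B.
  move=> e; apply: (cB (fx2 B, fy1 B)); first by split=> /=; lra.
  by apply: on_frame_vertical; lra.
have n3 : fy1 A <> fy1 B.
  move=> e; apply: (cA (fx2 A, fy1 A)); first by split=> /=; lra.
  by apply: on_frame_horizontal; lra.
have n4 : fy2 A <> fy2 B.
  move=> e; apply: (cA (fx2 A, fy2 A)); first by split=> /=; lra.
  by apply: on_frame_horizontal; lra.
have n5 : fx1 A < fx1 B.
  apply: Rnot_le_lt => le; apply: lA; exists (fx1 A, fy1 B).
  split; first by split=> /=; lra.
  by apply: on_frame_horizontal; lra.
by split; lra.
Qed.

Lemma meets_pokes_out (A B : frame) :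
  (forall p, corner A p -> ~ on_frame B p) ->
  (forall p, corner B p -> ~ on_frame A p) ->
  ~ meets (left_side A) (on_frame B) -> ~ meets (left_side B) (on_frame A) ->
  (meets (right_side A) (on_frame B) ->
     meets (right_side A) (top_side B) /\ meets (right_side A) (bottom_side B)) ->
  (meets (right_side B) (on_frame A) ->
     meets (right_side B) (top_side A) /\ meets (right_side B) (bottom_side A)) ->
  meets (on_frame A) (on_frame B) -> pokes_out B A \/ pokes_out A B.
Proof.
move=> cA cB lA lB rA rB [p [pA pB]].
case: (pA) => [h|[h|hA]]; first by case: lA; exists p.
  by left; case: rA => [|? ?]; [exists p | exact: right_side_pokes_out].
case: (pB) => [h|[h|hB]]; first by case: lB; exists p.
  by right; case: rB => [|? ?]; [exists p | exact: right_side_pokes_out].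
(* The common point lies on horizontal sides of both frames. At its height, the left end of the side
   starting further right is a corner on the other frame. *)
exfalso.
have Ax := fx_lt A; have Bx := fx_lt B.
case: p hA hB {pA pB} => x y.
rewrite /bottom_side /top_side /= => hA hB.
have [le|lt] := Rle_lt_dec (fx1 A) (fx1 B).
  apply: (cB (fx1 B, y)); first by split=> /=; lra.
  by apply: on_frame_horizontal; lra.
apply: (cA (fx1 A, y)); first by split=> /=; lra.
by apply: on_frame_horizontal; lra.
Qed.

Lemma exists_maximum (T : finType) (f : T -> R) (Z : T -> Prop) :
  (exists x, Z x) -> exists2 x, Z x & forall y, Z y -> f y <= f x.
Proof.
move=> [x0 Zx0].
suff [x Zx mx] : exists2 x, Z x & forall y, y \in enum T -> Z y -> f y <= f x.
  by exists x => // y; apply: mx; rewrite mem_enum.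
elim: (enum T) => [|a s [x Zx mx]]; first by exists x0.
have [[Za lt]|h] := classic (Z a /\ f x < f a).
  exists a => // y; rewrite inE => /predU1P[-> _|ys Zy]; first exact: Rle_refl.
  by apply: Rle_trans (Rlt_le _ _ lt); exact: mx.
exists x => // y; rewrite inE => /predU1P[-> Za|]; last exact: mx.
by apply: Rnot_lt_le => lt; apply: h.
Qed.

(* Subdivisions of K_4 with oriented paths *)
Local Close Scope R_scope.

(* [node i j t] is the [t]-th vertex after [br i] on the path of length [len i j] from
   [br i] to [br j]; both orientations of each path are recorded. *)
Record K4_subdivision (V : finType) (adj : rel V) := K4Subdivision {
  br : 'I_4 -> V;
  len : 'I_4 -> 'I_4 -> nat;
  node : 'I_4 -> 'I_4 -> nat -> V;
  node0 : forall i j, node i j 0 = br i;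
  br_inj : injective br;
  len_ge3 : forall i j, i != j -> 2 < len i j;
  len_sym : forall i j, i != j -> len j i = len i j;
  node_rev : forall i j t, i != j -> t <= len i j -> node j i t = node i j (len i j - t);
  node_surj : forall v, exists i j t, [/\ i != j, t <= len i j & v = node i j t];
  node_inj : forall i j k l t r, i != j -> k != l -> 0 < t < len i j -> r <= len k l ->
    node k l r = node i j t ->
    [/\ k = i, l = j & r = t] \/ [/\ k = j, l = i & r = len i j - t];
  adj_node : forall x y, adj x y <->
    exists i j t, [/\ i != j, t < len i j, x = node i j t & y = node i j t.+1] }.

Arguments br_inj {V adj} S : rename.
Arguments len_ge3 {V adj} S {i j} : rename.
Arguments len_sym {V adj} S {i j} : rename.
Arguments node_rev {V adj} S {i j t} : rename.
Arguments node_surj {V adj} S v : rename.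
Arguments node_inj {V adj} S {i j k l t r} : rename.
Arguments adj_node {V adj} S {x y} : rename.

Lemma ord4_avoid3 (i j k : 'I_4) : exists l : 'I_4, [/\ l != i, l != j & l != k].
Proof.
suff /existsP[l /and3P[]] : [exists l, [&& l != i, l != j & l != k]] by exists l.
apply: contraT; rewrite negb_exists => /forallP h.
have : [set: 'I_4] \subset i |: [set j; k].
  by apply/subsetP => l _; move: (h l); rewrite !inE !negb_and !negbK.
move/subset_leq_card; rewrite cardsT card_ord cardsU1 cards2.
by case: (_ \notin _); case: (_ != _).
Qed.

Lemma ord4_avoid2 (i j : 'I_4) : exists k : 'I_4, k != i /\ k != j.
Proof. by have [k [? ? _]] := ord4_avoid3 i j j; exists k. Qed.

Section Subdivision.
Variables (V : finType) (adj : rel V) (S : K4_subdivision adj).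
Hypothesis adj_sym : symmetric adj.

Local Notation br := (br S).
Local Notation len := (len S).
Local Notation node := (node S).

Lemma node_len i j : i != j -> node i j (len i j) = br j.
Proof.
move=> ij; rewrite -(node0 S j i) (node_rev S ij) ?subn0 //.
Qed.

Lemma node_br i j k t : i != j -> t <= len i j -> node i j t = br k ->
  (k = i /\ t = 0) \/ (k = j /\ t = len i j).
Proof.
move=> ij tL e; have L3 := len_ge3 S ij.
have [t0|t0] := posnP t.
  by left; move: e; rewrite t0 node0 => /(br_inj S).
have [tl|tl] := eqVneq t (len i j).
  by right; move: e; rewrite tl node_len // => /(br_inj S).
(* Writing [br k] as the start of a path towards any other [m] makes [node_inj] applicable; it then
   makes [0] an interior position. *)
have [m [mk _]] := ord4_avoid2 k k; rewrite eq_sym in mk.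
rewrite -(node0 S k m) in e.
have tt : 0 < t < len i j by lia.
by case: (node_inj S ij mk tt (leq0n _) (esym e)) => -[_ _]; lia.
Qed.

(** The node is interior, hence on this path only, or it is [br i]. In both cases every path through
    it has [i] as an end; [t < len i j] keeps [br j] out. *)
Lemma node_eq_end i j k l t r : i != j -> k != l -> t < len i j -> r <= len k l ->
  node k l r = node i j t ->
  (k = i /\ (l = j /\ r = t \/ r = 0 /\ t = 0)) \/
  (l = i /\ (k = j /\ r = len i j - t \/ r = len k l /\ t = 0)).
Proof.
move=> ij kl tL rL e; have [t0|t0] := posnP t.
  by move: e; rewrite t0 node0 => /(node_br kl rL) [[-> ->]|[-> ->]]; tauto.
have tt : 0 < t < len i j by lia.
by case: (node_inj S ij kl tt rL e) => -[-> -> ->]; tauto.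
Qed.

Lemma node_inj1 i j t r : i != j -> t <= len i j -> r <= len i j ->
  node i j r = node i j t -> r = t.
Proof.
move=> ij tL rL e.
have [tl|tl] := eqVneq t (len i j).
  move: e; rewrite tl node_len // => /(node_br ij rL) [[ji _]|[] //].
  by rewrite ji eqxx in ij.
have tt : t < len i j by lia.
case: (node_eq_end ij ij tt rL e) => -[h]; first by lia.
by rewrite h eqxx in ij.
Qed.

Lemma adj_succ i j t : i != j -> t < len i j -> adj (node i j t) (node i j t.+1).
Proof. by move=> ij tL; apply/(adj_node S); exists i, j, t. Qed.

Lemma adj_pred i j t : i != j -> 0 < t <= len i j -> adj (node i j t) (node i j t.-1).
Proof.
by case: t => // t ij tL; rewrite adj_sym adj_succ.
Qed.

Lemma adj_interior i j t y : i != j -> 0 < t < len i j -> adj (node i j t) y ->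
  y = node i j t.-1 \/ y = node i j t.+1.
Proof.
move=> ij tt /(adj_node S) [k [l [r [kl rL e ->]]]].
case: (node_inj S ij kl tt (ltnW rL) (esym e)) => -[? ? er]; subst k l; rewrite er; first by right.
(* The edge was read along the reversed path, where the successor is the predecessor. *)
left; rewrite (node_rev S ij); first by congr (node i j _); lia.
by lia.
Qed.

Lemma adj_br i y : adj (br i) y -> exists2 j, i != j & y = node i j 1.
Proof.
move=> /(adj_node S) [k [l [r [kl rL e ->]]]].
case: (node_br kl (ltnW rL) (esym e)) => -[ek er]; first by exists l; rewrite ?ek // er.
by lia.
Qed.

(** * Subdivided triangles *)

(* The subdivided triangle opposite to [br i]. *)
Definition triangle i v := exists j k t,
  [/\ j != i, k != i, j != k, t <= len j k & v = node j k t].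

Lemma triangle_avoid i j t : i != j -> t < len i j -> ~ triangle i (node i j t).
Proof.
move=> ij tL [k [l [r [ki li kl rL e]]]].
case: (node_eq_end ij kl tL rL (esym e)) => -[h _]; first by rewrite h eqxx in ki.
by rewrite h eqxx in li.
Qed.

Lemma triangle_neighbours i v : triangle i v -> exists y z,
  [/\ triangle i y, triangle i z, adj v y, adj v z & y != z /\ ~~ adj y z].
Proof.
have br_case j : j != i -> exists y z,
  [/\ triangle i y, triangle i z, adj (br j) y, adj (br j) z & y != z /\ ~~ adj y z].
  move=> ji; have [k [ki kj]] := ord4_avoid2 i j.
  have [l [li lj lk]] := ord4_avoid3 i j k.
  rewrite eq_sym in kj; rewrite eq_sym in lj.
  have K3 := len_ge3 S kj; have L3 := len_ge3 S lj.
  exists (node j k 1), (node j l 1); split.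
  - by exists j, k, 1; split => //; lia.
  - by exists j, l, 1; split => //; lia.
  - by rewrite -(node0 S j k) adj_succ //; lia.
  - by rewrite -(node0 S j l) adj_succ //; lia.
  have ne t : 0 < t < len j k -> node j l 1 <> node j k t.
    move=> tt e; case: (node_inj S kj lj tt _ e); first by lia.
      by case=> _ h; rewrite h eqxx in lk.
    by case=> h; rewrite h eqxx in kj.
  split; first by apply/eqP => /esym; apply: ne; lia.
  (* Adjacency would put [node j l 1] at position 0 or 2 of the path towards [br k]; position 2 is
     interior because the path has at least three edges. *)
  apply/negP => /(adj_interior kj) []; [lia | | apply: ne; lia].
  by rewrite node0 => /(node_br lj) []; [lia | lia | case=> h; rewrite h eqxx in lj].
move=> [j [k [t [ji ki jk tL ->]]]]; have L3 := len_ge3 S jk.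
have [->|t0] := posnP t; first by rewrite node0; exact: br_case.
have [->|tl] := eqVneq t (len j k); first by rewrite node_len //; exact: br_case.
exists (node j k t.-1), (node j k t.+1); split.
- by exists j, k, t.-1; split => //; lia.
- by exists j, k, t.+1; split => //; lia.
- by rewrite adj_pred //; lia.
- by rewrite adj_succ //; lia.
have ne r s : r <= len j k -> s <= len j k -> r != s -> node j k r <> node j k s.
  by move=> rL sL /eqP rs /(node_inj1 jk) h; apply: rs; apply: h.
split; first by apply/eqP; apply: ne; lia.
apply/negP => a.
(* [adj_interior] needs an interior node: the predecessor if [1 < t], and otherwise the successor,
   at position 2. *)
have [t1|t1] := ltnP 1 t.
  by case: (adj_interior jk _ a); [lia | apply: ne; lia | apply: ne; lia].
rewrite adj_sym in a.
by case: (adj_interior jk _ a); [lia | apply: ne; lia | apply: ne; lia].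
Qed.

(** * Connectivity after removing a closed neighbourhood *)

Definition nbhd v x := x = v \/ adj v x.

(** Connectivity is phrased through predicates [C] preserved along the remaining edges; symmetry of
    [adj] turns preservation into equivalence. *)
Lemma invariant_along_path (C : V -> Prop) v i j s t :
  (forall x y, adj x y -> ~ nbhd v x -> ~ nbhd v y -> C x -> C y) ->
  i != j -> s <= t <= len i j -> (forall r, s <= r <= t -> ~ nbhd v (node i j r)) ->
  C (node i j s) <-> C (node i j t).
Proof.
move=> inv ij; elim: t => [|t IH] st out; first by have -> : s = 0 by lia.
have [->//|ne] := eqVneq s t.+1.
rewrite IH; [|lia|by move=> r rr; apply: out; lia].
have o1 : ~ nbhd v (node i j t) by apply: out; lia.
have o2 : ~ nbhd v (node i j t.+1) by apply: out; lia.
have a : adj (node i j t) (node i j t.+1) by apply: adj_succ => //; lia.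
by split; apply: inv => //; rewrite adj_sym.
Qed.

(** A last interior vertex becomes the first one after reversing its path. With [t.+1 < len i j],
    the closed neighbourhood stops short of [br j]. *)
Lemma star_normal_form v : exists i,
  (v = br i) \/ exists j t, [/\ i != j, 0 < t, t.+1 < len i j & v = node i j t].
Proof.
have [i [j [t [ij tL ->]]]] := node_surj S v; have L3 := len_ge3 S ij.
have [->|t0] := posnP t; first by exists i; left; rewrite node0.
have [->|tl] := eqVneq t (len i j); first by exists j; left; rewrite node_len.
have [lt|ge] := ltnP t.+1 (len i j); first by exists i; right; exists j, t.
exists j; right; exists i, (len i j - t); split; rewrite 1?eq_sym //; try by lia.
  by rewrite (len_sym S ij); lia.
by rewrite (node_rev S ij) ?subKn //; lia.
Qed.

Lemma nbhd_interior i j s w : i != j -> 0 < s < len i j ->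
  nbhd (node i j s) w <-> exists2 r, s.-1 <= r <= s.+1 & w = node i j r.
Proof.
move=> ij ss; split=> [[->|/(adj_interior ij ss) [->|->]]|[r rr ->]].
- by exists s => //; lia.
- by exists s.-1 => //; lia.
- by exists s.+1 => //; lia.
have [->|rs] := eqVneq r s; first by left.
have [->|rs'] := eqVneq r s.+1; first by right; apply: adj_succ => //; lia.
by right; rewrite (_ : r = s.-1) ?adj_pred //; lia.
Qed.

Lemma nbhd_br i w : nbhd (br i) w <-> exists j r, [/\ i != j, r <= 1 & w = node i j r].
Proof.
split=> [[->|/adj_br [j ij ->]]|[j [r [ij r1 ->]]]].
- have [j [_ ji]] := ord4_avoid2 i i; exists j, 0.
  by rewrite node0 eq_sym.
- by exists j, 1.
case: r r1 => [|[|//]] _; first by left; rewrite node0.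
by right; rewrite -(node0 S i j) adj_succ //; have := len_ge3 S ij; lia.
Qed.

Lemma star_complement_connected (C : V -> Prop) v x y :
  (forall x y, adj x y -> ~ nbhd v x -> ~ nbhd v y -> C x -> C y) ->
  ~ nbhd v x -> ~ nbhd v y -> C x -> C y.
Proof.
move=> inv nx ny.
have walk := @invariant_along_path C v _ _ _ _ inv.
have [i hv] := star_normal_form v.
(* By [triangle_avoid], the removed set is thus disjoint from the triangle opposite [br i], which
   survives whole and links its branch vertices. It remains to reach it from every surviving
   vertex. *)
have nb w : nbhd v w -> exists j t, [/\ i != j, t < len i j & w = node i j t].
  case: hv => [->|[j [t [ij t0 tL ->]]]].
    move=> /nbhd_br [j [r [ij r1 ->]]]; exists j, r; split=> //.
    by have := len_ge3 S ij; lia.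
  move=> /(nbhd_interior _ ij) [|r rr ->]; first by lia.
  by exists j, r; split=> //; lia.
have brs j k : j != i -> k != i -> C (br j) <-> C (br k).
  move=> ji ki; have [->//|jk] := eqVneq j k.
  rewrite -(node0 S j k) -(node_len jk); apply: walk => //; [by lia | move=> r rL].
  move=> /nb [l [t [il tL e]]]; apply: (triangle_avoid il tL); rewrite -e.
  by exists j, k, r; split=> //; lia.
suff from_i l t : i != l -> t <= len i l -> ~ nbhd v (node i l t) ->
    exists2 j, j != i & C (node i l t) <-> C (br j).
  have reach w : ~ nbhd v w -> exists2 j, j != i & C w <-> C (br j).
    have [k [l [t [kl tL ->]]]] := node_surj S w; have [ki|ki] := eqVneq k i.
      by rewrite ki in kl tL *; exact: from_i.
    have [li|li] := eqVneq l i.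
      have lk : l != k by rewrite eq_sym.
      rewrite -(len_sym S kl) in tL.
      by rewrite (node_rev S lk tL); subst l; apply: from_i => //; lia.
    exists k => //; rewrite -(node0 S k l); symmetry; apply: walk => // r rL.
    move=> /nb [m [s [im sL e]]]; apply: (triangle_avoid im sL); rewrite -e.
    by exists k, l, r; split=> //; lia.
  have [j ji ->] := reach _ nx; have [k ki ->] := reach _ ny.
  by rewrite (brs _ _ ji ki).
move=> il tL nw.
case: hv => [vi|[j [s [ij s0 sL vs]]]].
  rewrite {}vi in nw walk.
  have t1 : 1 < t.
    by rewrite ltnNge; apply/negP => t1; apply/nw/nbhd_br; exists l, t.
  exists l; first by rewrite eq_sym.
  rewrite -(node_len il); apply: walk => //; first by lia.
  move=> r rr /nbhd_br [k [r' [ik r'1 e]]].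
  have r'L : r' < len i k by have := len_ge3 S ik; lia.
  case: (node_eq_end ik il r'L _ e); [lia | lia |].
  by case=> h; rewrite h eqxx in il.
have ss : 0 < s < len i j by lia.
(* Walking away from [br i] is safe: on a path not ending in [br j], only position 0 can be
   removed. *)
have other k r : i != k -> k != j -> r <= len i k -> ~ nbhd v (node i k r) ->
    exists2 j, j != i & C (node i k r) <-> C (br j).
  move=> ik kj rL nr; exists k; first by rewrite eq_sym.
  rewrite -(node_len ik); apply: walk => //; first by lia.
  move=> r' rr' nr'; move: (nr'); rewrite vs => /(nbhd_interior _ ij ss) [q qq e].
  case: (node_eq_end ij ik _ _ e); [lia | lia | |]; last first.
    by case=> h; rewrite h eqxx in ik.
  case=> _ [[h _]|[r0 _]]; first by rewrite h eqxx in kj.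
  by apply: nr; rewrite (_ : r = r') //; lia.
have [lj|lj] := eqVneq l j; last exact: other.
rewrite {l}lj in il tL nw *.
have ts : t < s.-1 \/ s.+1 < t.
  suff : ~ (s.-1 <= t <= s.+1) by lia.
  by move=> ts; apply: nw; rewrite vs; apply/nbhd_interior => //; exists t.
have off r : r <= len i j -> r < s.-1 \/ s.+1 < r -> ~ nbhd v (node i j r).
  move=> rL rs; rewrite vs => /(nbhd_interior _ ij ss) [q qq].
  by move=> /(node_inj1 ij) h; have := h _ rL; lia.
(* Before the removed stretch, the way leads back to [br i] and out along another path; beyond it,
   on to [br j]. *)
case: ts => ts.
  have [k [ki kj]] := ord4_avoid2 i j; rewrite eq_sym in ki.
  have [|m mi e] := other k 0 ki kj (leq0n _).
    by rewrite node0 -(node0 S i j); apply: off; lia.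
  exists m => //; rewrite -e node0 -(node0 S i j); symmetry.
  by apply: walk => // r rr; apply: off; lia.
exists j; first by rewrite eq_sym.
rewrite -(node_len ij).
by apply: walk => //; [lia | move=> r rr; apply: off; lia].
Qed.

(** A branch vertex in [B] would confine [B] to its closed neighbourhood, which misses the opposite
    triangle. So [B] sits around an interior vertex of one path, within a stretch of two edges, too
    short to meet the triangles opposite both ends of that path. *)
Lemma triangle_transversal_not_clique (B : V -> Prop) :
  (forall x y, B x -> B y -> x != y -> adj x y) ->
  ~ (forall i, exists2 x, triangle i x & B x).
Proof.
move=> clique hit.
have no_br j : ~ B (br j).
  move=> Bj; have [x tx Bx] := hit j.
  have nx : nbhd (br j) x.
    by have [->|ne] := eqVneq x (br j); [left | right; apply: clique; rewrite 1?eq_sym].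
  have /nbhd_br [k [r [jk r1 e]]] := nx.
  apply: (@triangle_avoid j k r) => //; last by rewrite -e.
  by have := len_ge3 S jk; lia.
have [u [j [k [t [_ _ jk tL eu]]]] Bu] := hit ord0.
have L3 := len_ge3 S jk.
have t0 : 0 < t by case: t tL eu => // _ eu; case: (no_br j); rewrite -(node0 S j k) -eu.
have tl : t < len j k.
  rewrite ltn_neqAle tL andbT; apply/eqP => tl.
  by case: (no_br k); rewrite -(node_len jk) -tl -eu.
have near x : B x -> exists2 r, t.-1 <= r <= t.+1 & x = node j k r.
  move=> Bx; apply/nbhd_interior => //; first by lia.
  rewrite -eu; have [->|ne] := eqVneq x u; [by left | right].
  by apply: clique; rewrite 1?eq_sym.
have [x tx Bx] := hit j; have [y ty By] := hit k.
have [r rr er] := near x Bx; have [s ss es] := near y By.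
(* On this path, the triangle opposite [br j] contains only [br k], and the one opposite [br k] only
   [br j]. *)
have rl : len j k <= r.
  by rewrite leqNgt; apply/negP => rl; apply: (triangle_avoid jk rl); rewrite -er.
have s0 : s = 0.
  have [//|s0] := posnP s.
  have kj : k != j by rewrite eq_sym.
  case: (@triangle_avoid k j (len k j - s) kj); first by rewrite (len_sym S jk); lia.
  by rewrite (len_sym S jk) (node_rev S jk) ?leq_subr // subKn -?es //; lia.
by lia.
Qed.

End Subdivision.

(** * From lists of interior vertices to oriented paths *)

Lemma mem_K4_pairs (i j : 'I_4) : ((i, j) \in K4_pairs) = (i < j).
Proof.
rewrite /K4_pairs mem_filter /= andb_idr // => _.
by apply/allpairsP; exists (i, j); rewrite !mem_enum.
Qed.

Lemma uniq_flatten_map_inj (I T : eqType) (f : I -> seq T) (s : seq I) :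
  uniq (flatten (map f s)) ->
  {in s, forall i, uniq (f i)} /\
  {in s &, forall i j x, x \in f i -> x \in f j -> i = j}.
Proof.
elim: s => [|a s IH] //=; rewrite cat_uniq => /and3P[ua /hasPn dis /IH [us inj]].
have out i x : i \in s -> x \in f i -> x \notin f a.
  by move=> si xi; apply: dis; apply/flatten_mapP; exists i.
split=> [i|i j]; first by rewrite inE => /predU1P[->|/us].
rewrite !inE => /predU1P[->|si] /predU1P[->|sj] x xi xj //.
- by move: (out _ _ sj xj); rewrite xi.
- by move: (out _ _ si xi); rewrite xj.
by apply: inj xi xj.
Qed.

Section FromDefinition.
Variables (V : finType) (adj : rel V) (b : 'I_4 -> V) (P : 'I_4 -> 'I_4 -> seq V).

Let all_vertices :=
  [seq b i | i <- enum 'I_4] ++ flatten [seq P p.1 p.2 | p <- K4_pairs].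

Hypothesis size_P : forall p, p \in K4_pairs -> 2 <= size (P p.1 p.2).
Hypothesis uniq_all : uniq all_vertices.
Hypothesis all_mem : forall v, v \in all_vertices.
Hypothesis adjE : forall x y : V, adj x y <->
  exists2 p, p \in K4_pairs &
    (consec (subdiv_path b P p) x y \/ consec (subdiv_path b P p) y x).

(** [P] is constrained on increasing pairs only, so the other orientation is obtained by reversal.
    The diagonal value is junk, excluded by [i != j] in the lemmas on disjointness and reversal. *)
Definition inner (i j : 'I_4) : seq V := if i < j then P i j else rev (P j i).
Definition walk (i j : 'I_4) : seq V := b i :: rcons (inner i j) (b j).

Lemma ltn_ord_neq (i j : 'I_4) : i != j -> (i < j) || (j < i).
Proof. by rewrite -neq_ltn. Qed.

Lemma inner_rev i j : i != j -> inner j i = rev (inner i j).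
Proof.
move=> ij; rewrite /inner; case/orP: (ltn_ord_neq ij) => lt.
  by rewrite lt ltnNge (ltnW lt).
by rewrite lt ltnNge (ltnW lt) /= revK.
Qed.

Lemma walk_rev i j : i != j -> walk j i = rev (walk i j).
Proof. by move=> ij; rewrite /walk (inner_rev ij) rev_cons rev_rcons. Qed.

Lemma size_walk i j : size (walk i j) = (size (inner i j)).+2.
Proof. by rewrite /= size_rcons. Qed.

Lemma inner_P i j x : i != j -> x \in inner i j ->
  exists2 p, p \in K4_pairs & x \in P p.1 p.2 /\ (p = (i, j) \/ p = (j, i)).
Proof.
move=> ij; rewrite /inner; case/orP: (ltn_ord_neq ij) => lt.
  by rewrite lt => h; exists (i, j); rewrite ?mem_K4_pairs //; split=> //; left.
rewrite ltnNge (ltnW lt) /= mem_rev => h.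
by exists (j, i); rewrite ?mem_K4_pairs //; split=> //; right.
Qed.

Lemma uniq_inner i j : i != j -> uniq (inner i j).
Proof.
move: uniq_all; rewrite cat_uniq => /and3P[_ _ /uniq_flatten_map_inj [u _]] ij.
rewrite /inner; case/orP: (ltn_ord_neq ij) => lt.
  by rewrite lt; apply: (u (i, j)); rewrite mem_K4_pairs.
by rewrite ltnNge (ltnW lt) /= rev_uniq; apply: (u (j, i)); rewrite mem_K4_pairs.
Qed.

Lemma inner_inj i j k l x : i != j -> k != l -> x \in inner i j -> x \in inner k l ->
  (k = i /\ l = j) \/ (k = j /\ l = i).
Proof.
move: uniq_all; rewrite cat_uniq => /and3P[_ _ /uniq_flatten_map_inj [_ inj]] ij kl.
move=> /(inner_P ij) [p pK [xp ep]] /(inner_P kl) [q qK [xq eq]].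
have pq : p = q by apply: inj xp xq.
by move: ep eq; rewrite pq => -[] -> [] [] -> ->; tauto.
Qed.

Lemma b_inj : injective b.
Proof.
move: uniq_all; rewrite cat_uniq => /and3P[+ _ _].
by rewrite -/(image_mem _ _) => /injectiveP.
Qed.

Lemma b_notin_inner i j k : i != j -> b k \notin inner i j.
Proof.
move: uniq_all; rewrite cat_uniq => /and3P[_ /hasPn dis _] ij.
apply/negP => /(inner_P ij) [p pK [xp _]].
have : b k \in flatten [seq P p.1 p.2 | p <- K4_pairs] by apply/flatten_mapP; exists p.
by move/dis => /negP; apply; apply: map_f; rewrite mem_enum.
Qed.

Lemma uniq_walk i j : i != j -> uniq (walk i j).
Proof.
move=> ij; rewrite /= rcons_uniq mem_rcons inE negb_or (inj_eq b_inj) ij.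
by rewrite !b_notin_inner // uniq_inner.
Qed.

(** Both indices are in range, so the defaults in [consec] may be replaced by the fixed [b i]. *)
Lemma consec_walk i j x y : consec (walk i j) x y <->
  exists t, [/\ t < (size (inner i j)).+1, x = nth (b i) (walk i j) t
             & y = nth (b i) (walk i j) t.+1].
Proof.
split=> [[t [tL [ex ey]]]|[t [tL -> ->]]].
  rewrite size_walk in tL; exists t; split=> //.
    by rewrite -[LHS]ex; apply: set_nth_default; rewrite size_walk; lia.
  by rewrite -[LHS]ey; apply: set_nth_default; rewrite size_walk; lia.
exists t; rewrite size_walk; split=> //.
by split; apply: set_nth_default; rewrite size_walk; lia.
Qed.

Lemma nth_walk_rev i j t : i != j -> t <= (size (inner i j)).+1 ->
  nth (b j) (walk j i) t = nth (b i) (walk i j) ((size (inner i j)).+1 - t).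
Proof.
move=> ij tL; rewrite (walk_rev ij) nth_rev size_walk ?ltnS // subSS.
by apply: set_nth_default; rewrite size_walk; lia.
Qed.

Lemma size_inner_sym i j : i != j -> size (inner j i) = size (inner i j).
Proof. by move=> ij; rewrite (inner_rev ij) size_rev. Qed.

Lemma subdiv_path_walk (i j : 'I_4) : i < j -> subdiv_path b P (i, j) = walk i j.
Proof. by move=> lt; rewrite /subdiv_path /walk /inner lt. Qed.

Lemma adj_walk x y : adj x y <-> exists i j t,
  [/\ i != j, t < (size (inner i j)).+1, x = nth (b i) (walk i j) t
    & y = nth (b i) (walk i j) t.+1].
Proof.
split=> [/adjE [[i j]]|[i [j [t [ij tL -> ->]]]]].
  rewrite mem_K4_pairs => lt; have ij : i != j by rewrite -(inj_eq val_inj) neq_ltn lt.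
  rewrite (subdiv_path_walk lt) => -[/consec_walk [t [tL -> ->]]|/consec_walk [t [tL -> ->]]].
    by exists i, j, t.
  have ji : j != i by rewrite eq_sym.
  have e := size_inner_sym ij.
  (* The walk has [(size (inner i j)).+1] edges, so edge [t] is edge [size (inner i j) - t] of the
     reversed walk. *)
  exists j, i, (size (inner i j) - t); split=> //; rewrite ?e; first by lia.
    by rewrite nth_walk_rev // ?e; [congr nth|]; lia.
  by rewrite nth_walk_rev // ?e; [congr nth|]; lia.
apply/adjE; case/orP: (ltn_ord_neq ij) => lt.
  exists (i, j); rewrite ?mem_K4_pairs // (subdiv_path_walk lt).
  by left; apply/consec_walk; exists t.
have ji : j != i by rewrite eq_sym.
have e := size_inner_sym ij.
exists (j, i); rewrite ?mem_K4_pairs // (subdiv_path_walk lt).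
right; apply/consec_walk; exists (size (inner i j) - t); rewrite e.
split; first by lia.
  by rewrite nth_walk_rev // ?e; [congr nth|]; lia.
by rewrite nth_walk_rev // ?e; [congr nth|]; lia.
Qed.

Lemma K4_subdivision_of_paths : K4_subdivision adj.
Proof.
apply: (@K4Subdivision _ _ b (fun i j => (size (inner i j)).+1)
          (fun i j => nth (b i) (walk i j))) => //.
- exact: b_inj.
- move=> i j ij; rewrite ltnS /inner; case/orP: (ltn_ord_neq ij) => lt.
    by rewrite lt; apply: (size_P (p := (i, j))); rewrite mem_K4_pairs.
  rewrite [i < j]ltnNge (ltnW lt) size_rev; apply: (size_P (p := (j, i))).
  by rewrite mem_K4_pairs.
- by move=> i j ij; rewrite size_inner_sym.
- by move=> i j t ij tL; rewrite nth_walk_rev.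
- move=> v; have := all_mem v; rewrite mem_cat => /orP[/mapP[i _ ->]|].
    by have [j [_ ji]] := ord4_avoid2 i i; exists i, j, 0; rewrite eq_sym.
  move=> /flatten_mapP [[i j]]; rewrite mem_K4_pairs /= => lt vP.
  have ij : i != j by rewrite -(inj_eq val_inj) neq_ltn lt.
  have vw : v \in inner i j by rewrite /inner lt.
  (* The shift by one accounts for [b i] at position 0. *)
  exists i, j, (index v (inner i j)).+1; split=> //; first by rewrite ltnS ltnW ?index_mem.
  by rewrite /= nth_rcons index_mem vw nth_index.
- move=> i j k l t r ij kl tt rL e.
  have vw : nth (b i) (walk i j) t \in inner i j.
    case: t tt {e} => // t tt; rewrite /= nth_rcons ifT; last by lia.
    by apply: mem_nth; case/andP: tt.
  (* A node equal to an interior vertex is no branch vertex, hence interior too; [inner_inj] then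
     identifies the path and [uniq_walk] the position. *)
  have vw' : nth (b k) (walk k l) r \in inner k l.
    case: r rL e => [_ /= e|r rL]; first by move: vw; rewrite -e (negbTE (b_notin_inner _ ij)).
    rewrite /= nth_rcons; case: ltnP => [lt _|ge]; first by apply: mem_nth.
    rewrite ifT; last by lia.
    by move=> e; move: vw; rewrite -e (negbTE (b_notin_inner _ ij)).
  rewrite e in vw'; case: (inner_inj ij kl vw vw') => -[? ?]; subst k l.
    left; split=> //; apply/eqP.
    rewrite -(nth_uniq (b i) _ _ (uniq_walk ij)) ?size_walk; [by rewrite e|lia|lia].
  right; split=> //; rewrite size_inner_sym // in rL.
  rewrite nth_walk_rev // in e.
  suff : (size (inner i j)).+1 - r = t by lia.
  apply/eqP.
  by rewrite -(nth_uniq (b i) _ _ (uniq_walk ij)) ?size_walk; [rewrite e|lia|lia].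
exact: adj_walk.
Qed.

End FromDefinition.

(** * Nested frames in a subdivision of K_4 *)

Theorem theorem3p8 (V : finType) (adj : rel V) :
  symmetric adj -> irreflexive adj ->
  ge2_subdivision_K4 adj -> ~ restricted_frame_graph adj.
Proof.
move=> adj_sym adj_irr [b [P [sizeP uniqP memP adjP]]].
have {b P sizeP uniqP memP adjP} S := K4_subdivision_of_paths sizeP uniqP memP adjP.
move=> [F [adjF corners lefts rights _]].
have adj_neq u v : adj u v -> u != v.
  by move=> a; apply/eqP => e; rewrite e adj_irr in a.
have adj_pokes u v : adj u v -> pokes_out (F v) (F u) \/ pokes_out (F u) (F v).
  move=> a; have uv := adj_neq _ _ a; have vu : v != u by rewrite eq_sym.
  apply: meets_pokes_out; try by [exact: corners | exact: lefts | exact: rights].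
  exact/adjF.
have adj_not_nested u v : nested (F u) (F v) -> ~ nbhd adj v u.
  move=> [n1 n2 n3 n4] [e|/adj_pokes [[]|[]]]; try lra.
  by rewrite e in n1; lra.
pose big v := exists w, nested (F w) (F v).
have big_all v x : big v -> ~ nbhd adj v x -> nested (F x) (F v).
  move=> [w nw] nx.
  apply: (star_complement_connected S adj_sym (C := fun z => nested (F z) (F v)) _ _ nx nw);
    last exact: adj_not_nested.
  (* If [F z] were not nested in [F v], then, being disjoint from it, it could not meet [F y] inside
     it, although [y] and [z] are adjacent. *)
  move=> y z yz ny nz nyv; apply: NNPP => nzv.
  have zv : z != v by apply/eqP => e; apply: nz; left.
  apply: (not_meets_across nyv nzv); last by apply/adjF => //; exact: adj_neq.
  by move/adjF => /(_ zv) a; apply: nz; right; rewrite adj_sym.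
apply: (triangle_transversal_not_clique (S := S) adj_sym (B := big) _ _) => [u v bu bv uv|i].
  (* Non-adjacent big frames would be nested in each other. *)
  apply: contraT => nuv; exfalso.
  have [n1 _ _ _] : nested (F v) (F u).
    apply: big_all => // -[e|a]; first by rewrite e eqxx in uv.
    by rewrite a in nuv.
  have [n2 _ _ _] : nested (F u) (F v).
    apply: big_all => // -[e|a]; first by rewrite e eqxx in uv.
    by rewrite adj_sym a in nuv.
  by lra.
have [|v tv vmax] := exists_maximum (fun v => fx1 (F v)) (Z := triangle S i).
  have [j [ji _]] := ord4_avoid2 i i; have [k [ki kj]] := ord4_avoid2 i j.
  by exists (node S j k 0), j, k, 0; split=> //; rewrite eq_sym.
have [y [z [ty tz vy vz [yz nyz]]]] := triangle_neighbours adj_sym tv.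
(* The frame poking out has its left side further right, so maximality of [v] fixes the
   direction. *)
have into w : triangle S i w -> adj v w -> pokes_out (F v) (F w).
  by move=> /vmax le /adj_pokes [[]|//]; lra.
case: (pokes_out_meets_or_nested (into y ty vy) (into z tz vz)) => [m|n|n].
- by case/negP: nyz; apply/adjF.
- by exists z => //; exists y.
by exists y => //; exists z.
Qed.
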